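(* Let $C\ge 1$ and let $\mathcal{S}_1,\dots,\mathcal{S}_C$ be Polish spaces. For each multi-index $\mathbf{N}=(N_i)_{1\le i\le C}\in\mathbb{N}^C$ (with $N_i\ge1$), let $(X^{\mathbf{N}}_{n,i})_{1\le n\le N_i,\,1\le i\le C}$ be a finite multi-exchangeable multi-class system, $X^{\mathbf{N}}_{n,i}$ having state space $\mathcal{S}_i$, with empirical measure vector $(\Lambda^{\mathbf{N}}_i)_{1\le i\le C}$. Let $(X_{n,i})_{n\ge1,\,1\le i\le C}$ be an infinite multi-exchangeable system, $X_{n,i}$ having state space $\mathcal{S}_i$, with directing measure vector $(\Lambda_i)_{1\le i\le C}$. Then $$\lim_{\mathbf{N}\to\infty}(X^{\mathbf{N}}_{n,i})_{1\le n\le N_i,\,1\le i\le C}=(X_{n,i})_{n\ge1,\,1\le i\le C}\quad\text{in law}$$ if and only if $$\lim_{\mathbf{N}\to\infty}(\Lambda^{\mathbf{N}}_i)_{1\le i\le C}=(\Lambda_i)_{1\le i\le C}\quad\text{in law}$$ (as random elements of $\mathcal{P}(\mathcal{S}_1)\times\cdots\times\mathcal{P}(\mathcal{S}_C)$).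
   Context: $\lim_{\mathbf{N}\to\infty}$ denotes the limit along a fixed arbitrary subsequence of $\mathbf{N}\in\mathbb{N}^C$ such that $\min_{1\le i\le C}N_i$ goes to infinity. For $k\ge1$, $\Sigma(k)$ is the set of permutations of $\{1,\dots,k\}$. For a Polish space $\mathcal{S}$, $\mathcal{P}(\mathcal{S})$ is the space of Borel probability measures on $\mathcal{S}$ with the weak topology (again Polish); products carry the product topology. $\mathcal{L}$ denotes the law of a random element. A finite multi-class system $(X^{\mathbf{N}}_{n,i})_{1\le n\le N_i,\,1\le i\le C}$ ($X^{\mathbf{N}}_{n,i}$ with values in $\mathcal{S}_i$) is multi-exchangeable if $$\mathcal{L}\bigl((X^{\mathbf{N}}_{\sigma_i(n),i})_{1\le n\le N_i,\,1\le i\le C}\bigr)=\mathcal{L}\bigl((X^{\mathbf{N}}_{n,i})_{1\le n\le N_i,\,1\le i\le C}\bigr)\quad\text{for all }\sigma_i\in\Sigma(N_i),\ 1\le i\le C.$$ Its empirical measure vector is $(\Lambda^{\mathbf{N}}_i)_{1\le i\le C}$ with $\Lambda^{\mathbf{N}}_i=\frac1{N_i}\sum_{n=1}^{N_i}\delta_{X^{\mathbf{N}}_{n,i}}$. A multi-class system with infinite classes $(X_{n,i})_{n\ge1,\,1\le i\le C}$ is multi-exchangeable if every finite sub-system $(X_{n,i})_{1\le n\le N_i,\,1\le i\le C}$ is multi-exchangeable. Then for each $i$ the sequence $(X_{n,i})_{n\ge1}$ is infinite exchangeable and has a directing measure, the random element of $\mathcal{P}(\mathcal{S}_i)$ given by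 the almost sure weak limit $\Lambda_i=\lim_{N\to\infty}\frac1N\sum_{n=1}^N\delta_{X_{n,i}}$; the vector $(\Lambda_i)_{1\le i\le C}$ is called the directing measure vector. Convergence in law of the finite systems to the infinite system means that for every $k\ge1$ the law of $(X^{\mathbf{N}}_{n,i})_{1\le n\le k,\,1\le i\le C}$ (defined once $\min_i N_i\ge k$) converges weakly to the law of $(X_{n,i})_{1\le n\le k,\,1\le i\le C}$. *)

(* Defs.v *)
From HB Require Import structures.
From mathcomp Require Import all_boot all_order all_algebra all_fingroup.
From mathcomp Require Import all_classical all_reals all_analysis.
From mathcomp Require Import measurable_realfun.

Set Implicit Arguments.
Unset Strict Implicit.
Unset Printing Implicit Defensive.
Import Order.TTheory GRing.Theory Num.Theory.
Import numFieldNormedType.Exports.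
Local Open Scope classical_set_scope.
Local Open Scope ring_scope.

Definition polish (R : realType) (T : topologicalType) : Prop :=
  (exists2 D : set T, countable D & dense D) /\
  exists dist : T -> T -> R,
    [/\ [/\ forall x, dist x x = 0,
            forall x y, dist x y = 0 -> x = y,
            forall x y, dist x y = dist y x &
            forall x y z, dist x z <= dist x y + dist y z],
        forall (x : T) (A : set T),
          nbhs x A <-> exists2 e : R, 0 < e & [set y | dist x y < e] `<=` A &
        forall u : nat -> T,
          (forall e : R, 0 < e -> exists n0 : nat, forall m n : nat,
             (n0 <= m)%N -> (n0 <= n)%N -> dist (u m) (u n) < e) ->
          exists l : T, u @ \oo --> l].

Section product.
Context {I : Type}.

HB.instance Definition _ (T : I -> ptopologicalType) :=
  isPointed.Build (prod_topology T) (fun i => point).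

Lemma prod_proj_continuous (T : I -> topologicalType) (i : I) :
  continuous (fun x : prod_topology T => x i).
Proof.
move=> x A nA.
have := @cvg_sup _ _ (fun i => Topological.class (initial_topology
  (fun f : (forall i, T i) => f i))) (nbhs (x : prod_topology T)) x _.
move=> [+ _] => /(_ cvg_id i); apply.
exact: (@initial_continuous _ _ (fun f : (forall i, T i) => f i) x).
Qed.

Lemma prod_continuous (X : topologicalType) (T : I -> topologicalType)
    (h : X -> prod_topology T) :
  (forall i, continuous (fun x => h x i)) -> continuous h.
Proof.
move=> hc x; apply/cvg_sup => i.
move=> A /= [_ [[B oB <-] Bx sBA]].
apply: filterS sBA _.
apply: (hc i x); exact: open_nbhs_nbhs.
Qed.

End product.

Definition borel (T : ptopologicalType) := g_sigma_algebraType (@open T).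

Lemma continuous_borel (T U : ptopologicalType) (f : T -> U) :
  continuous f -> measurable_fun setT (f : borel T -> borel U).
Proof.
move=> /continuousP fc; apply: (measurability (@open U : set (set (borel U)))) => //.
move=> _ [B oB <-]; rewrite setTI; apply: sub_sigma_algebra; exact: fc.
Qed.

Lemma continuous_borel_real (R : realType) (T : ptopologicalType) (f : T -> R) :
  continuous f -> measurable_fun setT (f : borel T -> R).
Proof.
move=> /continuousP fc.
apply: (measurability _ (RGenOpens.measurableE R)).
move=> _ [_ [a [b ->]] <-]; rewrite setTI; apply: sub_sigma_algebra.
by apply: fc; exact: interval_open.
Qed.

Section weak_topology.
Variables (R : realType) (S : ptopologicalType).

Definition bounded_continuous : Type :=
  {f : S -> R | continuous f /\ bounded_fun f}.

(* Two elements of [probability (borel S) R] which agree on Borel sets may still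
   differ as terms, on non-measurable sets. They have the same integrals, hence
   the same neighbourhoods below, so that no open set, continuous function or
   Borel set of [Prob] tells them apart. *)
Definition Prob : Type := probability (borel S) R.

Definition test (mu : Prob) : {ptws bounded_continuous -> R} :=
  fun f => \int[mu]_x (sval f x).

HB.instance Definition _ := Pointed.on Prob.
HB.instance Definition _ :=
  Topological.copy Prob (initial_topology test).

Lemma weak_cvgP (F : set_system Prob) (mu : Prob) : Filter F ->
  F --> mu <-> forall f : S -> R, continuous f -> bounded_fun f ->
    (fun nu : Prob => \int[nu]_x f x) @ F --> \int[mu]_x f x.
Proof.
move=> FF; split=> [Fmu f fc fb|Fmu].
  pose bf : bounded_continuous := exist _ f (conj fc fb).
  have cbf : continuous (fun nu : Prob => test nu bf).
    move=> nu; apply: (@continuous_comp _ _ _ (test : Prob -> _)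
      (fun g : {ptws bounded_continuous -> R} => g bf)).
      exact: initial_continuous.
    exact: prod_proj_continuous.
  by move=> A /cbf /Fmu.
have testF : test @ F --> test mu.
  apply/cvg_sup => f A /= [_ [[B oB <-] Bf sBA]].
  apply: filterS sBA _.
  have [fc fb] := svalP f.
  by apply: (Fmu _ fc fb); exact: open_nbhs_nbhs.
move=> A /= [_ [[B oB <-] Bmu sBA]].
by apply: filterS sBA _; apply: testF; exact: open_nbhs_nbhs.
Qed.

End weak_topology.

Section law.
Context d (Omega : measurableType d) (R : realType) (P : probability Omega R)
  (T : ptopologicalType).

Definition continuous_rv (U : ptopologicalType) (f : T -> U)
    (fc : continuous f) (Y : {RV P >-> borel T}) : {RV P >-> borel U} :=
  HB.pack_for {mfun Omega >-> borel U} ((f : borel T -> borel U) \o Y)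
    (isMeasurableFun.Build _ _ Omega (borel U) (f \o Y)
       (measurableT_comp (continuous_borel fc) (measurable_funPT Y))).

Definition law (Y : {RV P >-> borel T}) : Prob R T := distribution P Y.

End law.

(* The equality is restricted to Borel sets because [law P Y] is a function
   defined on all sets. *)
Definition same_law d1 d2 (Omega1 : measurableType d1)
    (Omega2 : measurableType d2) (R : realType) (P1 : probability Omega1 R)
    (P2 : probability Omega2 R) (T : ptopologicalType)
    (Y1 : {RV P1 >-> borel T}) (Y2 : {RV P2 >-> borel T}) : Prop :=
  forall A : set (borel T), measurable A -> law Y1 A = law Y2 A.

Section empirical.
Context (R : realType) (S : ptopologicalType) (N : nat).
Local Open Scope ereal_scope.

(* The value for [N = 0] is a placeholder, needed for totality. *)
Definition empirical (x : 'I_N -> S) (A : set (borel S)) : \bar R :=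
  if N == 0%N then dirac (point : borel S) A
  else (N%:R^-1)%:E * \sum_(n < N) dirac (x n : borel S) A.

Variable x : 'I_N -> S.

Let empirical0 : empirical x set0 = 0.
Proof.
rewrite /empirical; case: ifP => _.
  exact: (measure0 (@dirac _ (borel S) point R)).
rewrite big1 ?mule0 // => n _; exact: (measure0 (@dirac _ (borel S) (x n) R)).
Qed.

Let empirical_ge0 A : 0 <= empirical x A.
Proof.
rewrite /empirical; case: ifP => _; first exact: measure_ge0.
apply: mule_ge0; first by rewrite lee_fin invr_ge0 ler0n.
by apply: sume_ge0 => i _; exact: measure_ge0.
Qed.

Let empirical_additive : semi_sigma_additive (empirical x).
Proof.
rewrite /empirical; case: (N == 0%N); first exact: measure_semi_sigma_additive.
move=> F mF tF mUF; rewrite [X in X @ _ --> _](_ : _ = fun m =>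
    (N%:R^-1)%:E * \sum_(n < N) \sum_(0 <= k < m) dirac (x n : borel S) (F k)).
  apply: cvgeZl => //.
  apply: cvg_nnesum => //.
    by move=> n _; apply: nearW => m; apply: sume_ge0 => k _; exact: measure_ge0.
  by move=> n _; exact: measure_semi_sigma_additive.
apply/funext => m; rewrite -ge0_sume_distrr.
  by congr (_ * _); rewrite exchange_big.
by move=> k _; apply: sume_ge0 => n _; exact: measure_ge0.
Qed.

HB.instance Definition _ := isMeasure.Build _ _ _ (empirical x)
  empirical0 empirical_ge0 empirical_additive.

Let empirical1 : empirical x setT = 1.
Proof.
rewrite /empirical; case: ifPn => [_|N0]; first exact: probability_setT.
under eq_bigr do rewrite diracT.
rewrite sumEFin sumr_const card_ord -EFinM mulVf // pnatr_eq0.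
by [].
Qed.

HB.instance Definition _ := Measure_isProbability.Build _ _ _ (empirical x)
  empirical1.

Definition empirical_measure : Prob R S := empirical x.

End empirical.

Section empirical_continuous.
Context (R : realType) (S : ptopologicalType).

Let ge0_integral_empirical N (x : 'I_N -> S) (g : borel S -> \bar R) :
  (0 < N)%N -> measurable_fun setT g -> (forall y, 0 <= g y)%E ->
  (\int[empirical R x]_y g y =
   (N%:R^-1)%:E * \sum_(n < N) g (x n))%E.
Proof.
case: N x => // N x _ mg g0.
pose m := msum (fun k => @dirac _ (borel S) (x (inord k)) R) N.+1.
have k0 : 0 <= (N.+1%:R : R)^-1 by rewrite invr_ge0 ler0n.
rewrite (@eq_measure_integral _ _ _ _ (mscale (NngNum k0) m)); last first.
  move=> A mA _; rewrite /empirical /mscale /m /msum /=.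
  by congr (_ * _)%E; apply: eq_bigr => n _; rewrite inord_val.
rewrite ge0_integral_mscale //= ge0_integral_measure_sum //.
congr (_ * _)%E; apply: eq_bigr => n _.
by rewrite integral_dirac // diracT mul1e inord_val.
Qed.

Lemma Rintegral_empirical N (x : 'I_N -> S) (f : S -> R) :
  (0 < N)%N -> continuous f ->
  \int[empirical_measure R x]_y f y = N%:R^-1 * \sum_(n < N) f (x n).
Proof.
move=> N0 /continuous_borel_real mf.
have mEf : measurable_fun setT (EFin \o f : borel S -> \bar R).
  exact/measurable_EFinP.
rewrite /Rintegral integralE !ge0_integral_empirical //; last 2 first.
- exact: measurable_funeneg.
- exact: measurable_funepos.
have sumE (g : 'I_N -> R) :
    (\sum_(n < N) (g n)%:E = (\sum_(n < N) g n)%:E)%E by rewrite sumEFin.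
transitivity (fine ((N%:R^-1 * \sum_(n < N) Num.max (f (x n)) 0)%:E
  - (N%:R^-1 * \sum_(n < N) Num.max (- f (x n)) 0)%:E)%E).
  congr (fine (_ - _)%E).
    rewrite EFinM -sumE; congr (_ * _)%E; apply: eq_bigr => n _.
    by rewrite funeposE /= -EFin_max.
  rewrite EFinM -sumE; congr (_ * _)%E; apply: eq_bigr => n _.
  by rewrite funenegE /= -EFin_max.
rewrite /= -mulrBr -sumrB; congr (_ * _); apply: eq_bigr => n _.
have [fn0|fn0] := leP 0 (f (x n)).
  by rewrite max_r ?subr0 // oppr_le0.
by rewrite max_l ?sub0r ?opprK // oppr_ge0 ltW.
Qed.

Lemma empirical_measure_continuous N :
  continuous (fun x : {ptws 'I_N -> S} => empirical_measure R (x : 'I_N -> S)).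
Proof.
apply: continuous_comp_initial.
apply: prod_continuous => f x.
have [N0|N0] := posnP N.
  subst N.
  have -> : (fun z : {ptws 'I_0 -> S} => test (empirical_measure R z) f) =
            cst (test (empirical_measure R x) f).
    by apply/funext.
  exact: cvg_cst.
have [fc _] := svalP f.
have -> : (fun z : {ptws 'I_N -> S} => test (empirical_measure R z) f) =
          (fun z => N%:R^-1 * \sum_(n < N) sval f (z n)).
  by apply/funext => z; exact: Rintegral_empirical.
apply: cvgM; first exact: cvg_cst.
apply: cvg_big => [|n _]; first exact: add_continuous.
apply: (@continuous_comp _ _ _ (fun z : {ptws 'I_N -> S} => z n) (sval f)).
  exact: prod_proj_continuous.
exact: fc.
Qed.

End empirical_continuous.

Section systems.
Context (C : nat) (S : 'I_C -> ptopologicalType).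

(* Class [i] is indexed by [J i]: ['I_(N i)] for a finite system, [nat] for a
   system with infinite classes. Multi-class systems are random elements of this
   product; for Polish [S i] and countable [J i], its Borel sigma-algebra is the
   product of those of the factors. *)
Definition system (J : 'I_C -> Type) : ptopologicalType :=
  prod_topology (fun i => {ptws J i -> S i}).

Definition reindex (J K : 'I_C -> Type) (g : forall i, K i -> J i)
    (x : system J) : system K :=
  fun i k => x i (g i k).

Lemma reindex_continuous (J K : 'I_C -> Type) (g : forall i, K i -> J i) :
  continuous (reindex g : system J -> system K).
Proof.
apply: prod_continuous => i; apply: prod_continuous => k x.
apply: (@continuous_comp _ _ _ (fun z : system J => z i)
  (fun z : {ptws J i -> S i} => z (g i k))).
  exact: prod_proj_continuous.
exact: prod_proj_continuous.
Qed.

Definition rv_reindex d (Omega : measurableType d) (R : realType)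
    (P : probability Omega R) (J K : 'I_C -> Type) (g : forall i, K i -> J i)
    (X : {RV P >-> borel (system J)}) : {RV P >-> borel (system K)} :=
  continuous_rv (reindex_continuous (g := g)) X.

Definition measures (R : realType) : ptopologicalType :=
  prod_topology (fun i => Prob R (S i)).

Definition empirical_vector (R : realType) (N : 'I_C -> nat)
    (x : system (fun i => 'I_(N i))) : measures R :=
  fun i => empirical_measure R (x i).

Lemma empirical_vector_continuous (R : realType) (N : 'I_C -> nat) :
  continuous (@empirical_vector R N).
Proof.
apply: prod_continuous => i x.
apply: (@continuous_comp _ _ _
  (fun z : system (fun i => 'I_(N i)) => z i)
  (fun z : {ptws 'I_(N i) -> S i} => empirical_measure R (z : 'I_(N i) -> S i))).
  exact: prod_proj_continuous.
exact: empirical_measure_continuous.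
Qed.

End systems.

Section exchangeability.
Context (C : nat) (S : 'I_C -> ptopologicalType) (R : realType).

Definition finite_system (N : 'I_C -> nat) : ptopologicalType :=
  system S (fun i => 'I_(N i)).

Definition infinite_system : ptopologicalType := system S (fun=> nat).

Definition multi_exchangeable d (Omega : measurableType d)
    (P : probability Omega R) (N : 'I_C -> nat)
    (X : {RV P >-> borel (finite_system N)}) : Prop :=
  forall sigma : forall i, 'S_(N i), same_law (rv_reindex sigma X) X.

Definition subsystem d (Omega : measurableType d) (P : probability Omega R)
    (X : {RV P >-> borel infinite_system}) (N : 'I_C -> nat) :
    {RV P >-> borel (finite_system N)} :=
  rv_reindex (fun i (n : 'I_(N i)) => n : nat) X.

Definition infinite_multi_exchangeable d (Omega : measurableType d)
    (P : probability Omega R) (X : {RV P >-> borel infinite_system}) : Prop :=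
  forall N : 'I_C -> nat, (forall i, 0 < N i)%N ->
    multi_exchangeable (subsystem X N).

Definition directing_measure_vector d (Omega : measurableType d)
    (P : probability Omega R) (X : {RV P >-> borel infinite_system})
    (Lambda : {RV P >-> borel (measures S R)}) : Prop :=
  {ae P, forall w, forall i,
    empirical_measure R (fun n : 'I_N => X w i n) @[N --> \oo] --> Lambda w i}.

Definition empirical_measure_vector d (Omega : measurableType d)
    (P : probability Omega R) (N : 'I_C -> nat)
    (X : {RV P >-> borel (finite_system N)}) :
    {RV P >-> borel (measures S R)} :=
  continuous_rv (@empirical_vector_continuous C S R N) X.

(* The law of the first [k] rows. If some class has fewer than [k] members it
   is a placeholder, which does not affect limits as the class sizes tend to
   infinity. *)
Definition law_first_rows d (Omega : measurableType d)
    (P : probability Omega R) (N : 'I_C -> nat)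
    (X : {RV P >-> borel (finite_system N)}) (k : nat) :
    Prob R (finite_system (fun=> k)) :=
  if pselect (forall i, k <= N i)%N is left leN
  then law (rv_reindex (fun i => widen_ord (leN i)) X)
  else point.

Definition system_cvg_in_law (d : nat -> measure_display)
    (Omega : forall m, measurableType (d m))
    (P : forall m, probability (Omega m) R)
    (N : nat -> 'I_C -> nat)
    (X : forall m, {RV (P m) >-> borel (finite_system (N m))})
    d' (Omega' : measurableType d') (P' : probability Omega' R)
    (Y : {RV P' >-> borel infinite_system}) : Prop :=
  forall k : nat, (0 < k)%N ->
    law_first_rows (X m) k @[m --> \oo] --> law (subsystem Y (fun=> k)).

Definition cvg_in_law (T : ptopologicalType) (d : nat -> measure_display)
    (Omega : forall m, measurableType (d m))
    (P : forall m, probability (Omega m) R)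
    (Y : forall m, {RV (P m) >-> borel T})
    d' (Omega' : measurableType d') (P' : probability Omega' R)
    (Z : {RV P' >-> borel T}) : Prop :=
  law (Y m) @[m --> \oo] --> law Z.

(* [min_i N_i] tends to infinity along the sequence. *)
Definition tends_to_infinity (N : nat -> 'I_C -> nat) : Prop :=
  forall K : nat, \forall m \near \oo, forall i, (K <= N m i)%N.

End exchangeability.

(* Main.v *)
Require Import Defs.
From HB Require Import structures.
From mathcomp Require Import all_boot all_order all_algebra all_fingroup.
From mathcomp Require Import all_classical all_reals all_analysis.
From mathcomp Require Import measurable_realfun.
From mathcomp Require Import ring lra.

Set Implicit Arguments.
Unset Strict Implicit.
Unset Printing Implicit Defensive.
Import Order.TTheory GRing.Theory Num.Theory.
Import numFieldNormedType.Exports.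
Local Open Scope classical_set_scope.
Local Open Scope ring_scope.

(** Both convergences are equivalent to convergence of the same numbers, the
    expectations of products over the first rows.

    For an exchangeable system, the expectation of a product of bounded
    continuous functions of distinct members is, up to an error of the order of
    the inverse of the smallest class size, the expectation of the product of
    their integrals against the empirical measures
    ([row_product_measure_product]): a factor may be moved to any member of its
    class that the other factors do not read, hence may be averaged over almost
    the whole class. Letting the size of a subsystem of the infinite system tend
    to infinity gives the exact identity with the directing measures in place of
    the empirical ones ([directing_measure_product]). So the products of the
    finite systems have the right limits if and only if those of the empirical
    measures do.

    It remains that such products determine convergence in law, on the first
    rows as well as on vectors of measures. This is one statement
    ([cvg_moments]): if countably many bounded functions generate the topology
    of a space, then finite products of these functions, as test functions,
    determine weak convergence to a given limit. Indeed every bounded continuous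
    function has, below it, polynomials in the generating functions whose
    integral against the limit is as close as desired to its own
    ([lower_approximation]). A Polish space has such a family, made of truncated
    distances; products inherit it; and so does the space of probability
    measures, where the family consists of the integrals of the products
    ([initial_family_moments]). So the same criterion covers the systems and
    their empirical measure vectors. *)

(** * Uniform approximation by polynomials in a family of functions *)

Lemma normr_prod_le1 (R : realType) (I : Type) (r : seq I) (h : I -> R) :
  (forall i, `|h i| <= 1) -> `|\prod_(i <- r) h i| <= 1.
Proof.
move=> h1; elim: r => [|i r IHr]; first by rewrite big_nil normr1.
by rewrite big_cons normrM mulr_ile1.
Qed.

Section generated_algebra.
Context (R : realType) (T : Type) (J : Type) (u : J -> T -> R).
Hypothesis u_le1 : forall j x, `|u j x| <= 1.

Definition monomial (s : seq J) (x : T) : R := \prod_(j <- s) u j x.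

(** Polynomials are kept as explicit linear combinations of monomials, not as
    the closure of [u] under ring operations: integrals are linear but not
    multiplicative, so a convergence known for monomials passes to [p] only
    through this form. *)
Definition upoly (p : T -> R) : Prop :=
  exists l : seq (R * seq J),
    forall x, p x = \sum_(c <- l) c.1 * monomial c.2 x.

Definition approximable (f : T -> R) : Prop :=
  forall e : R, 0 < e ->
    exists2 p, upoly p & forall x, `|f x - p x| <= e.

Lemma monomial_le1 s x : `|monomial s x| <= 1.
Proof. exact: normr_prod_le1. Qed.

Lemma upoly_ext p q : p =1 q -> upoly p -> upoly q.
Proof. by move=> /funext ->. Qed.

Lemma upoly_cst a : upoly (fun=> a).
Proof.
by exists [:: (a, [::])] => x; rewrite big_seq1 /= /monomial big_nil mulr1.
Qed.

Lemma upoly_gen j : upoly (u j).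
Proof.
by exists [:: (1, [:: j])] => x; rewrite big_seq1 /= /monomial big_seq1 mul1r.
Qed.

Lemma upolyD p q : upoly p -> upoly q -> upoly (fun x => p x + q x).
Proof.
by move=> [l lE] [m mE]; exists (l ++ m) => x; rewrite big_cat /= -lE -mE.
Qed.

Lemma upolyM p q : upoly p -> upoly q -> upoly (fun x => p x * q x).
Proof.
move=> [l lE] [m mE].
exists [seq (c.1 * c'.1, c.2 ++ c'.2) | c <- l, c' <- m] => x.
rewrite big_allpairs_dep lE mE mulr_suml; apply: eq_bigr => c _.
rewrite mulr_sumr; apply: eq_bigr => c' _ /=.
by rewrite /monomial big_cat /= mulrACA.
Qed.

Lemma upolyZ a p : upoly p -> upoly (fun x => a * p x).
Proof. exact/upolyM/upoly_cst. Qed.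

Lemma upolyB p q : upoly p -> upoly q -> upoly (fun x => p x - q x).
Proof.
move=> hp /(upolyZ (-1)) /(upolyD hp); apply: upoly_ext => x.
by rewrite mulN1r.
Qed.

Lemma upoly_sum (I : Type) (r : seq I) (p : I -> T -> R) :
  (forall i, upoly (p i)) -> upoly (fun x => \sum_(i <- r) p i x).
Proof.
move=> hp; elim: r => [|i r IH].
  by apply: upoly_ext (upoly_cst 0) => x; rewrite big_nil.
by apply: upoly_ext (upolyD (hp i) IH) => x; rewrite big_cons.
Qed.

Lemma upoly_bounded p : upoly p -> exists2 M : R, 0 < M & forall x, `|p x| <= M.
Proof.
move=> [l lE]; exists (1 + \sum_(c <- l) `|c.1|).
  by rewrite ltr_pwDl // sumr_ge0.
move=> x; rewrite lE (le_trans (ler_norm_sum _ _ _)) //.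
rewrite ler_wpDl //; apply: ler_sum => c _.
by rewrite normrM ler_piMr // monomial_le1.
Qed.

(** Fixed-point iteration for the square root of [t ^+ 2]. Each iterate is a
    polynomial in [t], and the error [e] satisfies
    [e' = e * (1 - (`|t| + p) / 2)], so it decays like [1 / n] uniformly in [t]. *)
Fixpoint abs_iter (n : nat) (t : R) : R :=
  if n is n'.+1 then
    abs_iter n' t + 2^-1 * (t * t - abs_iter n' t * abs_iter n' t)
  else 0.

Lemma abs_iter_bound n t : `|t| <= 1 ->
  [/\ 0 <= abs_iter n t, abs_iter n t <= `|t| &
      `|t| - abs_iter n t <= 2 / n.+1%:R].
Proof.
move=> t1; elim: n => [|n [p0 pt tp]] /=.
  by rewrite lexx normr_ge0 subr0 divr1 (le_trans t1) // ler1n.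
set p := abs_iter n t in p0 pt tp *.
have tt : t * t = `|t| * `|t| by rewrite -expr2 -real_normK ?num_real.
have t0 := normr_ge0 t.
rewrite tt; move: tp t1 t0 pt; set a := `|t| => tp t1 t0 pt.
have n0 : (0 : R) <= n%:R by rewrite ler0n.
split; [nra | nra |].
set e := a - p in tp.
have -> : a - (p + 2^-1 * (a * a - p * p)) = e * (1 - (a + p) / 2).
  by rewrite /e; field.
have e0 : 0 <= e by rewrite subr_ge0.
have e1 : e <= 1 by rewrite /e; lra.
(* As e <= a, the contraction factor is at most 1 - e / 2. *)
have h1 : e * (1 - (a + p) / 2) <= e * (1 - e / 2)
  by rewrite /e in e0 *; nra.
apply: (le_trans h1).
rewrite ler_pdivlMr ?ltr0n //.
rewrite ler_pdivlMr ?ltr0n // in tp.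
rewrite -[n.+2%:R]natr1 -[n.+1%:R]natr1 in tp *; move: n%:R n0 tp => c c0 tp.
(* Either e is already below the new bound, or e is large enough for the
   factor 1 - e / 2 to improve 2 / (n + 1) to 2 / (n + 2). *)
have [e2|e2] := leP (e * (c + 1 + 1)) 2.
  have : e * (c + 1 + 1) * (1 - e / 2) <= 2 * (1 - e / 2).
    by rewrite ler_wpM2r //; lra.
  lra.
have : e * 2 <= e * (e * (c + 1 + 1)) by rewrite ler_wpM2l // ltW.
lra.
Qed.

Lemma upoly_abs_iter n p : upoly p -> upoly (fun x => abs_iter n (p x)).
Proof.
move=> hp; elim: n => [|n IH] /=; first exact: upoly_cst.
by apply: upolyD => //; apply: upolyZ; apply: upolyB; apply: upolyM.
Qed.

Lemma upoly_approximable p : upoly p -> approximable p.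
Proof. by move=> hp e e0; exists p => // x; rewrite subrr normr0 ltW. Qed.

Lemma approximableD f g :
  approximable f -> approximable g -> approximable (fun x => f x + g x).
Proof.
move=> hf hg e e0; have e2 : 0 < e / 2 by rewrite divr_gt0.
have [p hp fp] := hf _ e2; have [q hq gq] := hg _ e2.
exists (fun x => p x + q x); first exact: upolyD.
move=> x; rewrite opprD addrACA (le_trans (ler_normD _ _)) //.
by rewrite (splitr e) lerD.
Qed.

Lemma approximableZ a f : approximable f -> approximable (fun x => a * f x).
Proof.
move=> hf e e0; have a0 : 0 < `|a| + 1 by rewrite ltr_wpDl.
have [p hp fp] := hf _ (divr_gt0 e0 a0).
exists (fun x => a * p x); first exact: upolyZ.
move=> x; rewrite -mulrBr normrM (le_trans (ler_wpM2l _ (fp x))) //.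
by rewrite mulrCA ler_piMr ?(ltW e0) // ler_pdivrMr // mul1r lerDl.
Qed.

(** The iteration needs arguments in [-1, 1]: a polynomial close to [f] is
    bounded by some [M], and is divided by [M] first. *)
Lemma approximable_abs f : approximable f -> approximable (fun x => `|f x|).
Proof.
move=> hf e e0; have e2 : 0 < e / 2 by rewrite divr_gt0.
have [p hp fp] := hf _ e2.
have [M M0 pM] := upoly_bounded hp.
pose n := Num.truncn (4 * M / e).
have hn : 2 / n.+1%:R * M <= e / 2.
  have := truncnS_gt (4 * M / e); rewrite -/n ltr_pdivrMr // => hn.
  rewrite mulrAC ler_pdivrMr ?ltr0n //; nra.
exists (fun x => M * abs_iter n (M^-1 * p x)).
  exact/upolyZ/upoly_abs_iter/upolyZ.
move=> x.
have q1 : `|M^-1 * p x| <= 1.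
  by rewrite normrM normfV (gtr0_norm M0) mulrC ler_pdivrMr // mul1r.
have [q0 qle hq] := abs_iter_bound n q1.
rewrite (_ : `|f x| - _ = (`|f x| - `|p x|) +
    M * (`|M^-1 * p x| - abs_iter n (M^-1 * p x))); last first.
  by rewrite normrM normfV (gtr0_norm M0) mulrBr mulVKf ?gt_eqF //; ring.
rewrite (le_trans (ler_normD _ _)) // [leRHS]splitr lerD //.
  exact: le_trans (ler_dist_dist _ _) (fp x).
rewrite normrM gtr0_norm // ger0_norm ?subr_ge0 // mulrC.
by apply: le_trans hn; rewrite ler_pM2r.
Qed.

(** Uniform closure turns an algebra into a lattice; finite maxima are what the
    approximation of continuous functions from below consists of. *)
Lemma approximable_max f g : approximable f -> approximable g ->
  approximable (fun x => Num.max (f x) (g x)).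
Proof.
move=> hf hg.
have := approximableZ 2^-1 (approximableD (approximableD hf hg)
  (approximable_abs (approximableD hf (approximableZ (-1) hg)))).
rewrite (_ : (fun x => _) = (fun x => Num.max (f x) (g x))) //.
by apply/funext => x; rewrite mulN1r maxr_absE mulrC.
Qed.

End generated_algebra.

(** * Integrals of bounded functions against probability measures *)

Section bounded_integrals.
Context (R : realType).

Lemma bounded_fun_le (T : Type) (f : T -> R) (M : R) :
  (forall x, `|f x| <= M) -> bounded_fun f.
Proof.
move=> fM; exists M; split=> [|N MN x _]; first exact: num_real.
exact: le_trans (fM x) (ltW MN).
Qed.

Lemma bounded_fun_bound (T : Type) (f : T -> R) :
  bounded_fun f -> exists M : R, forall x, `|f x| <= M.
Proof.
by move=> [M [_ fM]]; exists (M + 1) => x; apply: fM => //; rewrite ltrDl.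
Qed.

Lemma Rintegral_cst1 d (T : measurableType d) (mu : probability T R) (a : R) :
  \int[mu]_x a = a.
Proof.
rewrite Rintegral_cst // -[RHS]mulr1; congr (_ * _).
exact: (congr1 fine (probability_setT mu)).
Qed.

Lemma integrable_bounded d (T : measurableType d) (mu : probability T R)
    (f : T -> R) (M : R) :
  measurable_fun setT f -> (forall x, `|f x| <= M) ->
  mu.-integrable setT (EFin \o f).
Proof.
move=> mf fM; apply: measurable_bounded_integrable => //.
  by rewrite ltey_eq fin_num_measure.
exact: bounded_fun_le fM.
Qed.

Lemma Rintegral_bound d (T : measurableType d) (mu : probability T R)
    (f : T -> R) (M : R) :
  measurable_fun setT f -> (forall x, `|f x| <= M) ->
  `|\int[mu]_x f x| <= M.
Proof.
move=> mf fM.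
have fi := integrable_bounded mu mf fM.
apply: (le_trans (le_normr_Rintegral measurableT fi)).
rewrite -[leRHS](Rintegral_cst1 mu).
apply: le_Rintegral => //.
- have mnf := measurableT_comp (@normr_measurable R setT) mf.
  have := integrable_bounded mu mnf (M := M).
  by apply=> x /=; rewrite normr_id.
- by apply: (integrable_bounded mu (M := `|M|)).
Qed.

Lemma bounded_convergence d (T : measurableType d) (mu : probability T R)
    (g : nat -> T -> R) (f : T -> R) (M : R) :
  (forall n, measurable_fun setT (g n)) -> measurable_fun setT f ->
  (forall n x, `|g n x| <= M) ->
  {ae mu, forall x, g n x @[n --> \oo] --> f x} ->
  \int[mu]_x g n x @[n --> \oo] --> \int[mu]_x f x.
Proof.
move=> mg mf gM gf.
have [|||||fi _ gfi] := @dominated_convergence _ T R mu setT measurableT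
  (fun n => EFin \o g n) (EFin \o f) (EFin \o cst M).
- by move=> n; apply/measurable_EFinP.
- exact/measurable_EFinP.
- apply: filterS gf => x gfx _.
  by apply/fine_cvgP; split; [exact: nearW | exact: gfx].
- by apply: (integrable_bounded mu (M := `|M|)).
- by apply/aeW => x n _; rewrite lee_fin.
- apply: fine_cvg; rewrite fineK //; exact: integrable_fin_num.
Qed.

Lemma integrable_continuous (T : ptopologicalType) (mu : Prob R T)
    (f : T -> R) (M : R) :
  continuous f -> (forall x, `|f x| <= M) ->
  mu.-integrable setT (EFin \o (f : borel T -> R)).
Proof.
move=> fc; apply: (@integrable_bounded _ (borel T) mu).
exact: continuous_borel_real.
Qed.

Lemma Rintegral_addr_cst (T : ptopologicalType) (mu : Prob R T)
    (f : T -> R) (M a : R) :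
  continuous f -> (forall x, `|f x| <= M) ->
  \int[mu]_x (f x + a) = \int[mu]_x f x + a.
Proof.
move=> fc fM.
have ia : mu.-integrable setT (EFin \o (cst a : borel T -> R)).
  by apply: (@integrable_continuous _ _ _ `|a|) => // x; exact: cvg_cst.
have fi := integrable_continuous mu fc fM.
by rewrite (RintegralD measurableT fi ia) Rintegral_cst1.
Qed.

End bounded_integrals.

(** * Families of bounded functions that generate a topology *)

Section initial_families.
Context (R : realType).

(** The topology of [T] is the initial one for [u]. For countable [J] this is
    second countability and complete regularity in one; the formulation by
    filters makes it pass to products at once and gives convergence criteria
    directly. The common bound 1 makes monomials bounded by 1 as well. *)
Definition initial_family (T : topologicalType) (J : Type) (u : J -> T -> R) :=
  [/\ forall j, continuous (u j), forall j x, `|u j x| <= 1 &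
      forall (F : set_system T) (x : T), Filter F ->
        (forall j, u j y @[y --> F] --> u j x) -> F --> x].

(** Applied to the filter generated by the finite intersections of strips
    [`|u j y - u j x| < e], the filter condition says that these intersections
    are a base of neighbourhoods of [x]. *)
Lemma initial_family_nbhs (T : topologicalType) (J : eqType) (u : J -> T -> R)
    (x : T) (A : set T) :
  initial_family u -> nbhs x A ->
  exists s : seq J, exists2 e : R, 0 < e &
    forall y, (forall j, j \in s -> `|u j y - u j x| < e) -> A y.
Proof.
move=> [_ _ uF] nA.
pose B (se : seq J * R) : set T :=
  [set y | forall j, j \in se.1 -> `|u j y - u j x| < se.2].
pose D : set (seq J * R) := [set se | 0 < se.2].
pose F := filter_from D B.
have FF : Filter F.
  apply: filter_from_filter; first by exists ([::], 1); exact: ltr01.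
  move=> [s e] [s' e'] /= e0 e'0.
  exists (s ++ s', Num.min e e') => /=; first by rewrite /D /= lt_min e0.
  move=> y /= yB; split=> j /= js.
    by have := yB j; rewrite mem_cat js lt_min => /(_ isT) /andP[].
  by have := yB j; rewrite mem_cat js orbT lt_min => /(_ isT) /andP[].
have /(_ _ nA)[[s e] /= e0 sA] : F --> x.
  apply: uF => j; apply/cvgrPdist_lt => e e0.
  exists ([:: j], e) => // y /= /(_ j (mem_head _ _)).
  by rewrite distrC.
by exists s, e.
Qed.

Lemma continuous_monomial (T : topologicalType) (J : Type) (u : J -> T -> R) s :
  (forall j, continuous (u j)) -> continuous (monomial u s).
Proof.
move=> uc; elim: s => [|j s IH].
  by rewrite (_ : monomial u _ = cst 1);
    [exact: cst_continuous | apply/funext => x; rewrite /monomial big_nil].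
rewrite (_ : monomial u _ = fun x => u j x * monomial u s x); last first.
  by apply/funext => x; rewrite /monomial big_cons.
by move=> x; apply: cvgM; [exact: uc | exact: IH].
Qed.

Lemma upoly_continuous (T : topologicalType) (J : Type) (u : J -> T -> R) p :
  (forall j, continuous (u j)) -> upoly u p -> continuous p.
Proof.
move=> uc [l lE].
rewrite (_ : p = fun x => \sum_(c <- l) c.1 * monomial u c.2 x); last first.
  exact/funext.
elim: l {lE} => [|c l IH].
  by under eq_fun do rewrite big_nil; exact: cst_continuous.
under eq_fun do rewrite big_cons.
move=> x; apply: cvgD; last exact: IH.
by apply: cvgM; [exact: cvg_cst | exact: continuous_monomial].
Qed.

Section paraboloids.
Context (T : topologicalType) (J : countType) (u : J -> T -> R).
Hypothesis uI : initial_family u.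

(** Parameters are rational so that there are countably many of them: a bounded
    continuous function then is the supremum of a sequence of paraboloids. *)
Definition paraboloid (c : rat * nat * seq (J * rat)) (x : T) : R :=
  ratr c.1.1 - c.1.2%:R * \sum_(b <- c.2) (u b.1 x - ratr b.2) ^+ 2.

Lemma upoly_paraboloid c : upoly u (paraboloid c).
Proof.
apply: upolyB; first exact: upoly_cst.
apply: upolyZ; apply: upoly_sum => b.
have h : upoly u (fun x => u b.1 x - ratr b.2).
  by apply: upolyB; [exact: upoly_gen | exact: upoly_cst].
exact: upolyM.
Qed.

(** A narrow paraboloid of height between [t] and [f x], with apex near [x],
    stays below [f]: near [x] because [f] exceeds its height there, and
    elsewhere because its curvature [l] is large enough to bring it below the
    lower bound [- M] of [f]. *)
Lemma exists_paraboloid (f : T -> R) (M : R) (x : T) (t : R) :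
  continuous f -> (forall y, `|f y| <= M) -> t < f x ->
  exists2 c, (forall y, paraboloid c y <= f y) & t < paraboloid c x.
Proof.
move=> fc fM tf.
have [q] := rat_in_itvoo tf; rewrite in_itv /= => /andP[tq qf].
have nA : nbhs x [set y | ratr q < f y].
  by have /cvgr_gt := fc x; apply.
have [s [e e0 sA]] := initial_family_nbhs uI nA.
have e24 : 0 < (e / 2) ^+ 2 by rewrite exprn_gt0 // divr_gt0.
pose l := (Num.truncn ((`|M| + `|ratr q|) / (e / 2) ^+ 2)).+1.
have hl : `|M| + `|ratr q| < l%:R * (e / 2) ^+ 2.
  have := truncnS_gt ((`|M| + `|ratr q|) / (e / 2) ^+ 2).
  by rewrite -/l ltr_pdivrMr.
have l0 : (0 : R) < l%:R by rewrite ltr0n.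
have M0 : 0 <= M by exact: le_trans (fM x).
(* The apex may miss x by del in each coordinate, at a cost of at most
   l * size s * del at x, which has to stay below ratr q - t. *)
pose del := Num.min (Num.min (e / 2) 1)
  ((ratr q - t) / (l%:R * (size s).+1%:R)).
have del0 : 0 < del.
  rewrite !lt_min divr_gt0 //= ltr01 divr_gt0 // ?subr_gt0 //.
  by rewrite mulr_gt0 // ltr0n.
have hq j : exists a : rat, `|u j x - ratr a| < del.
  have h : u j x - del < u j x + del by rewrite ltrD2l; lra.
  have [a] := rat_in_itvoo h; rewrite in_itv /= => /andP[h1 h2].
  by exists a; rewrite ltr_distlC h1.
have [a ha] := choice hq.
have dele : del <= e / 2 by rewrite /del !ge_min lexx.
have del1 : del <= 1 by rewrite /del !ge_min lexx orbT.
have delq : del * (l%:R * (size s).+1%:R) <= ratr q - t.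
  rewrite -ler_pdivlMr; first by rewrite /del ge_min lexx orbT.
  by rewrite mulr_gt0 // ltr0n.
exists (q, l, [seq (j, a j) | j <- s]).
  move=> y; rewrite /paraboloid /= big_map /=.
  have sum0 : 0 <= \sum_(j <- s) (u j y - ratr (a j)) ^+ 2.
    by apply: sumr_ge0 => j _; rewrite sqr_ge0.
  have [near_x|] := pselect (forall j, j \in s -> `|u j y - u j x| < e).
    rewrite (le_trans _ (ltW (sA _ near_x))) //.
    by rewrite lerBlDr lerDl mulr_ge0 // ltW.
  move=> /existsNP[j] /not_implyP[js] /negP; rewrite -leNgt => far.
  have hj : (e / 2) ^+ 2 <= (u j y - ratr (a j)) ^+ 2.
    rewrite -[leRHS]real_normK ?num_real //.
    rewrite lerXn2r ?nnegrE ?divr_ge0 ?(ltW e0) //.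
    have -> : u j y - ratr (a j) = (u j y - u j x) + (u j x - ratr (a j)).
      by ring.
    have := lerB_normD (u j y - u j x) (u j x - ratr (a j)).
    have := ha j; lra.
  have hs : (e / 2) ^+ 2 <= \sum_(j <- s) (u j y - ratr (a j)) ^+ 2.
    apply: le_trans hj _; rewrite (big_rem _ js) /= lerDl.
    by apply: sumr_ge0 => i _; rewrite sqr_ge0.
  have h1 : l%:R * (e / 2) ^+ 2 <=
      l%:R * \sum_(j <- s) (u j y - ratr (a j)) ^+ 2.
    by rewrite ler_wpM2l // ltW.
  have := fM y; rewrite ler_norml => /andP[fy _].
  have := ler_norm (ratr q : R).
  rewrite (ger0_norm M0) in hl; lra.
rewrite /paraboloid /= big_map /=.
have h1 : \sum_(j <- s) (u j x - ratr (a j)) ^+ 2 <= del * (size s)%:R.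
  rewrite -sum1_size natr_sum mulr_sumr; apply: ler_sum => j _.
  rewrite mulr1 -real_normK ?num_real // expr2.
  have := ha j; have := normr_ge0 (u j x - ratr (a j)); nra.
have h2 : l%:R * \sum_(j <- s) (u j x - ratr (a j)) ^+ 2 <=
    l%:R * (del * (size s)%:R).
  by rewrite ler_wpM2l // ltW.
have h3 : 0 < del * l%:R by rewrite mulr_gt0.
move: delq; rewrite -natr1; lra.
Qed.

End paraboloids.

End initial_families.

(** * Moments determine weak convergence *)

Section moments.
Context (R : realType) (T : ptopologicalType) (J : countType) (u : J -> T -> R).
Hypothesis uI : initial_family u.

Let uc : forall j, continuous (u j). Proof. by case: uI. Qed.
Let u1 : forall j x, `|u j x| <= 1. Proof. by case: uI. Qed.

(** By [exists_paraboloid], [f] is the pointwise supremum of the paraboloids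
    below it. These are countably many, so the maxima [g n] of the first ones
    increase to [f] and their integrals converge; [g n] in turn is a uniform
    limit of polynomials, lowered by [e / 4] to stay below [f]. *)
Lemma lower_approximation (mu : Prob R T) (f : T -> R) (M : R) (e : R) :
  continuous f -> (forall x, `|f x| <= M) -> 0 < e ->
  exists p, [/\ upoly u p, forall x, p x <= f x &
    \int[mu]_x f x - e <= \int[mu]_x p x].
Proof.
move=> fc fM e0.
pose below c := `[< forall y, paraboloid u c y <= f y >].
pose fix g n : T -> R := if n is n'.+1 then
    (if unpickle n' is Some c then
       if below c then fun x => Num.max (g n' x) (paraboloid u c x) else g n'
     else g n')
  else cst (- M).
have gA n : approximable u (g n).
  elim: n => [|n IH] /=.
    exact/upoly_approximable/upoly_cst.
  case: (unpickle n) => // c; case: ifP => // _.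
  exact/approximable_max/upoly_approximable/upoly_paraboloid.
have gc n : continuous (g n).
  elim: n => [|n IH] /=; first exact: cst_continuous.
  case: (unpickle n) => // c; case: ifP => // _.
  move=> x; apply: continuous_max; first exact: IH.
  exact/(upoly_continuous uc)/upoly_paraboloid.
have gf n x : - M <= g n x <= f x.
  elim: n => [|n /andP[IH1 IH2]] /=.
    by rewrite lexx; have := fM x; rewrite ler_norml => /andP[].
  case: (unpickle n) => [c|]; last exact/andP.
  case: ifP => [/asboolP bc|_]; last exact/andP.
  by rewrite le_max IH1 /= ge_max IH2 bc.
have gM n x : `|g n x| <= M.
  have /andP[h1 h2] := gf n x; rewrite ler_norml h1 (le_trans h2) //.
  exact: le_trans (ler_norm _) (fM x).
have gS n x : g n x <= g n.+1 x.
  rewrite /=; case: (unpickle n) => // c; case: ifP => // _.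
  by rewrite le_max lexx.
have g_ge n c x :
    unpickle n = Some c -> below c -> paraboloid u c x <= g n.+1 x.
  by move=> /= -> ->; rewrite le_max lexx orbT.
have gmono m n x : (m <= n)%N -> g m x <= g n x.
  move=> /subnKC <-; elim: (n - m)%N => [|k IH]; first by rewrite addn0.
  by rewrite addnS (le_trans IH).
have gcvg x : g n x @[n --> \oo] --> f x.
  apply/cvgrPdist_lt => r r0.
  have [|c cf ct] := @exists_paraboloid _ _ _ _ uI f M x (f x - r) fc fM.
    by rewrite ltrBlDr ltrDl.
  (* The paraboloid c has entered the maximum from stage pickle c + 1 on. *)
  exists (pickle c).+1 => // n /= cn.
  have /andP[_ h2] := gf n x.
  have pg : paraboloid u c x <= g (pickle c).+1 x.
    by apply: g_ge; [exact: pickleK | exact/asboolP].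
  have gm := gmono _ _ x cn.
  rewrite ger0_norm ?subr_ge0 //; lra.
clearbody g.
have mc h : continuous h -> measurable_fun setT (h : borel T -> R).
  exact: continuous_borel_real.
have : \int[mu]_x g n x @[n --> \oo] --> \int[mu]_x f x.
  apply: (bounded_convergence (M := M)); [|exact: mc|exact: gM|].
    by move=> n; exact: mc.
  by apply: aeW => x; exact: gcvg.
have e2 : 0 < e / 2 by rewrite divr_gt0.
have e4 : 0 < e / 2 / 2 by rewrite divr_gt0.
move=> /cvgrPdist_lt /(_ _ e2) [n _ /(_ n (leqnn _)) /= hn].
have [p pu hp] := gA n _ e4.
exists (fun x => p x + - (e / 2 / 2)); split.
- by apply: upolyD => //; exact: upoly_cst.
- move=> x; have /andP[_] := gf n x; have := hp x.
  rewrite ler_norml; lra.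
have [K K0 pK] := upoly_bounded u1 pu.
have ip : mu.-integrable setT (EFin \o (p : borel T -> R)).
  by apply: integrable_continuous pK; exact: upoly_continuous pu.
have ig : mu.-integrable setT (EFin \o (g n : borel T -> R)).
  exact: integrable_continuous (gM n).
have pc := upoly_continuous uc pu.
rewrite (Rintegral_addr_cst _ _ pc pK).
have : \int[mu]_x g n x <= \int[mu]_x (p x + e / 2 / 2).
  apply: le_Rintegral => //.
    apply: (@integrable_continuous _ _ _ _ (K + `|e / 2 / 2|)).
      move=> x; apply: cvgD; last exact: cvg_cst.
      exact: (upoly_continuous uc pu).
    by move=> x; rewrite (le_trans (ler_normD _ _)) // lerD2r.
  by move=> x _; have := hp x; rewrite ler_norml; lra.
rewrite (Rintegral_addr_cst _ _ pc pK).
move: hn; rewrite ltr_norml; lra.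
Qed.

Lemma Rintegral_upoly (mu : Prob R T) (l : seq (R * seq J)) :
  \int[mu]_x (\sum_(c <- l) c.1 * monomial u c.2 x) =
  \sum_(c <- l) c.1 * \int[mu]_x monomial u c.2 x.
Proof.
have im s : mu.-integrable setT (EFin \o (monomial u s : borel T -> R)).
  apply: integrable_continuous (monomial_le1 u1 s).
  exact: continuous_monomial.
have iZ c s : mu.-integrable setT
    (EFin \o (fun x : borel T => c * monomial u s x)).
  apply: (@integrable_continuous _ _ _ _ (`|c|)).
    move=> x; apply: cvgM; first exact: cvg_cst.
    exact: continuous_monomial.
  by move=> x; rewrite normrM ler_piMr // monomial_le1.
elim: l => [|c l IH].
  by under eq_Rintegral do rewrite big_nil; rewrite Rintegral_cst1 big_nil.
under eq_Rintegral do rewrite big_cons.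
rewrite big_cons RintegralD ?RintegralZl ?IH //.
pose p := fun x => \sum_(c <- l) c.1 * monomial u c.2 x.
have pu : upoly u p by exists l.
have [K K0 pK] := upoly_bounded u1 pu.
by apply: integrable_continuous pK; exact: upoly_continuous pu.
Qed.

(** A polynomial [p <= f] with almost the same integral against [mu] bounds
    [\int[nu] f] from below by [\int[nu] p], which converges by assumption;
    the same for [- f] bounds it from above. *)
Lemma cvg_moments (F : set_system (Prob R T)) (mu : Prob R T) : Filter F ->
  (forall s : seq J, \int[nu : Prob R T]_x monomial u s x @[nu --> F] -->
     \int[mu]_x monomial u s x) ->
  F --> mu.
Proof.
move=> FF mF; apply/weak_cvgP => f fc fb.
have [M fM] := bounded_fun_bound fb.
have lower (h : T -> R) : continuous h -> (forall x, `|h x| <= M) ->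
    forall e : R, 0 < e ->
    \forall nu \near F, \int[mu]_x h x - e < \int[nu : Prob R T]_x h x.
  move=> hc hM e e0; have e2 : 0 < e / 2 by rewrite divr_gt0.
  have [p [pu ph hp]] := lower_approximation mu hc hM e2.
  have pF : \int[nu : Prob R T]_x p x @[nu --> F] --> \int[mu]_x p x.
    have [l lE] := pu.
    have -> : p = fun x => \sum_(c <- l) c.1 * monomial u c.2 x by exact/funext.
    rewrite Rintegral_upoly (_ : (fun nu => _) = fun nu : Prob R T =>
        \sum_(c <- l) c.1 * \int[nu]_x monomial u c.2 x); last first.
      by apply/funext => nu; exact: Rintegral_upoly.
    apply: cvg_big => [|c _]; first exact: add_continuous.
    by apply: cvgM; [exact: cvg_cst | exact: mF].
  have [K K0 pK] := upoly_bounded u1 pu.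
  move/cvgrPdist_lt/(_ _ e2): pF; apply: filterS => nu.
  have : \int[nu]_x p x <= \int[nu]_x h x.
    apply: le_Rintegral => //.
    - by apply: integrable_continuous pK; exact: upoly_continuous pu.
    - exact: integrable_continuous hM.
  by rewrite ltr_norml; lra.
apply/cvgrPdist_lt => e e0.
have fNc : continuous (fun x => - f x) by move=> x; apply: cvgN; exact: fc.
have fNM x : `|- f x| <= M by rewrite normrN.
have NE (nu : Prob R T) : \int[nu]_x (- f x) = - \int[nu]_x f x.
  under eq_Rintegral do rewrite -mulN1r.
  rewrite RintegralZl ?mulN1r //.
  exact: integrable_continuous fM.
move: (lower _ fc fM _ e0) (lower _ fNc fNM _ e0).
by apply: filterS2 => nu; rewrite !NE ltr_norml; lra.
Qed.

(** The index type of the new family, finite sequences over [J], is countable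
    again. Hence the same criterion applies to laws of random measures. *)
Lemma initial_family_moments :
  initial_family (fun (s : seq J) (mu : Prob R T) => \int[mu]_x monomial u s x).
Proof.
have mc s : continuous (monomial u s) by exact: continuous_monomial.
split.
- move=> s mu; have [/(_ (@cvg_id _ _)) + _] := @weak_cvgP R T (nbhs mu) mu _.
  by move=> /(_ _ (mc s) (bounded_fun_le (monomial_le1 u1 s))).
- move=> s mu; apply: (@Rintegral_bound _ _ (borel T) mu) => [|x].
    exact: continuous_borel_real.
  exact: monomial_le1.
- by move=> F mu FF; exact: cvg_moments.
Qed.

End moments.

(** * Polish spaces and products *)

Section families_of_spaces.
Context (R : realType).

(** The family is made of the truncated distances to the points of a dense
    sequence [e]: a point [e n] within [r / 3] of [x] detects when [y] is
    within [r] of [x]. *)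
Lemma polish_initial_family (S : ptopologicalType) :
  polish R S -> exists u : nat -> S -> R, initial_family u.
Proof.
move=> [[D cD dD] [dist [[d0 _ dC dT] dN _]]].
have [e De] : exists e : nat -> S, D `<=` range e.
  have [x [_ Dx]] : setT `&` D !=set0.
    by apply: dD; [exists point | exact: openT].
  have /pfcard_geP[D0|[e]] := cD; first by rewrite D0 in Dx.
  by exists e => y /(@surj _ _ _ _ e) [n _ <-]; exists n.
have dge0 x y : 0 <= dist x y.
  have := dT x y x; rewrite d0 dC; lra.
have nball x r : 0 < r -> nbhs x [set y | dist x y < r].
  by move=> r0; apply/dN; exists r.
exists (fun n x => Num.min 1 (dist x (e n))); split.
- move=> n x; apply: continuous_min; first exact: cvg_cst.
  apply/cvgrPdist_lt => r r0.
  apply: filterS (nball x r r0) => y /= xy.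
  have := dT x y (e n); have := dT y x (e n); rewrite [dist y x]dC ltr_norml.
  lra.
- by move=> n x; rewrite ger0_norm ?ge_min ?lexx // le_min ler01 dge0.
- move=> F x FF uF A /dN[r r0 rA].
  pose r' := Num.min r 1.
  have r'0 : 0 < r' by rewrite lt_min r0 ltr01.
  have r3 : 0 < r' / 3 by rewrite divr_gt0.
  have [y [xy Dy]] : [set y | dist x y < r' / 3]^° `&` D !=set0.
    apply: dD; last exact: open_interior.
    exists x; exact: nball.
  have {}xy := interior_subset xy.
  have [n _ ny] := De _ Dy; subst y.
  have := uF n => /cvgrPdist_lt /(_ _ r3).
  apply: filterS => z /= h; apply: rA => /=.
  have r'1 : r' <= 1 by rewrite /r' ge_min lexx orbT.
  have r'r : r' <= r by rewrite /r' ge_min lexx.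
  have := dT x (e n) z; rewrite [dist (e n) z]dC => xz.
  move: h xy => /=; rewrite ltr_norml /Num.min; do 2 case: ifP => ?; lra.
Qed.

Lemma initial_family_prod (I : Type) (T : I -> topologicalType)
    (J : I -> Type) (u : forall i, J i -> T i -> R) :
  (forall i, initial_family (u i)) ->
  initial_family (fun (t : {i & J i}) (x : prod_topology T) =>
    u (tag t) (tagged t) (x (tag t))).
Proof.
move=> uI; split.
- move=> [i j] x /=.
  apply: (@continuous_comp _ _ _ (fun y : prod_topology T => y i) (u i j)).
    exact: prod_proj_continuous.
  by have [+ _ _] := uI i; exact.
- by move=> [i j] x /=; have [_ + _] := uI i; exact.
- move=> F x FF uF; apply/cvg_sup => i.
  have Fi : (fun y : prod_topology T => y i) @ F --> x i.
    have [_ _ uiF] := uI i; apply: uiF => j.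
    exact: (uF (existT _ i j)).
  move=> A /= [_ [[B oB <-] Bx sBA]].
  apply: filterS sBA _.
  by apply: Fi; exact: open_nbhs_nbhs.
Qed.

End families_of_spaces.

(** * Finite exchangeable systems: sampling against the empirical measures *)

Section integrals_of_laws.
Context (R : realType).

Lemma Rintegral_law d (Omega : measurableType d) (P : probability Omega R)
    (T : ptopologicalType) (Y : {RV P >-> borel T}) (f : T -> R) (M : R) :
  continuous f -> (forall x, `|f x| <= M) ->
  \int[law Y]_x f x = \int[P]_w f (Y w).
Proof.
move=> fc fM; congr fine.
have mf := continuous_borel_real fc.
have := @integral_pushforward _ _ _ (borel T) R Y (measurable_funPT Y) P setT
  (EFin \o f).
apply => //; first exact/measurable_EFinP.
rewrite preimage_setT.
apply: (@integrable_bounded _ _ _ _ (f \o Y) M) => [|w]; last exact: fM.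
exact: measurableT_comp.
Qed.

Lemma Rintegral_continuous_rv d (Omega : measurableType d)
    (P : probability Omega R) (T U : ptopologicalType) (g : T -> U)
    (gc : continuous g) (Y : {RV P >-> borel T}) (f : U -> R) (M : R) :
  continuous f -> (forall x, `|f x| <= M) ->
  \int[law (continuous_rv gc Y)]_y f y = \int[law Y]_x f (g x).
Proof.
move=> fc fM; rewrite (Rintegral_law _ fc fM).
rewrite (@Rintegral_law _ _ _ _ _ (f \o g) M) //.
  by move=> x; apply: continuous_comp; [exact: gc | exact: fc].
by move=> x; exact: fM.
Qed.

Lemma same_law_Rintegral d1 d2 (Omega1 : measurableType d1)
    (Omega2 : measurableType d2) (P1 : probability Omega1 R)
    (P2 : probability Omega2 R) (T : ptopologicalType)
    (Y1 : {RV P1 >-> borel T}) (Y2 : {RV P2 >-> borel T}) (f : T -> R) :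
  same_law Y1 Y2 -> \int[law Y1]_x f x = \int[law Y2]_x f x.
Proof.
move=> Y12; congr fine; apply: eq_measure_integral => A mA _; exact: Y12.
Qed.

End integrals_of_laws.

Section exchangeable_products.
Context (R : realType) (C : nat) (S : 'I_C -> ptopologicalType).
Context (N : 'I_C -> nat) d (Omega : measurableType d)
  (P : probability Omega R).
Variable X : {RV P >-> borel (finite_system S N)}.
Hypothesis N_gt0 : forall i, (0 < N i)%N.
Hypothesis X_exchangeable : multi_exchangeable X.

Local Notation position := {i : 'I_C & 'I_(N i)}.
Local Notation E h := (\int[law X]_x h x).

Definition coordinate (t : position) (x : finite_system S N) : S (tag t) :=
  x (tag t) (tagged t).

Lemma coordinate_continuous t : continuous (coordinate t).
Proof.
move=> x; apply: (@continuous_comp _ _ _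
  (fun z : finite_system S N => z (tag t))
  (fun z : {ptws 'I_(N (tag t)) -> S (tag t)} => z (tagged t))).
  exact: prod_proj_continuous.
exact: prod_proj_continuous.
Qed.

Definition permute (sigma : forall i, 'S_(N i)) (x : finite_system S N) :
    finite_system S N :=
  Defs.reindex (J := fun i => 'I_(N i)) (K := fun i => 'I_(N i))
    (fun i => sigma i) x.

Definition transpose (t : position) (m : 'I_(N (tag t))) :
    forall i, 'S_(N i) :=
  eqtype.dfwith (T := fun i => 'S_(N i)) (fun=> 1%g) (tperm (tagged t) m).

Lemma exchangeable_Rintegral (sigma : forall i, 'S_(N i))
    (h : finite_system S N -> R) (M : R) :
  continuous h -> (forall x, `|h x| <= M) ->
  E (fun x => h (permute sigma x)) = E h.
Proof.
move=> hc hM; rewrite -(same_law_Rintegral h (X_exchangeable sigma)).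
by rewrite (Rintegral_continuous_rv _ _ hc hM).
Qed.

Variable f : forall t : position, S (tag t) -> R.
Arguments f : clear implicits.
Hypothesis f_continuous : forall t, continuous (f t).
Hypothesis f_le1 : forall t y, `|f t y| <= 1.

Definition empirical_average (t : position) (x : finite_system S N) : R :=
  \int[empirical_measure R (x (tag t))]_y f t y.

Lemma empirical_averageE t x :
  empirical_average t x =
  (N (tag t))%:R^-1 * \sum_(m < N (tag t)) f t (x (tag t) m).
Proof. exact: Rintegral_empirical. Qed.

Lemma f_coordinate_continuous (t : position) (m : 'I_(N (tag t))) :
  continuous (fun x : finite_system S N => f t (x (tag t) m)).
Proof.
move=> x; apply: (@continuous_comp _ _ _
  (coordinate (existT (fun i => 'I_(N i)) (tag t) m)) (f t)).
  exact: coordinate_continuous.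
exact: f_continuous.
Qed.

Lemma empirical_average_continuous t : continuous (empirical_average t).
Proof.
rewrite (_ : empirical_average t = fun x =>
  (N (tag t))%:R^-1 * \sum_(m < N (tag t)) f t (x (tag t) m)); last first.
  by apply/funext => x; exact: empirical_averageE.
move=> x; apply: cvgM; first exact: cvg_cst.
apply: cvg_big => [|m _]; first exact: add_continuous.
exact: f_coordinate_continuous.
Qed.

Lemma empirical_average_le1 t x : `|empirical_average t x| <= 1.
Proof.
apply: (@Rintegral_bound _ _ (borel (S (tag t)))) => [|y].
  exact: continuous_borel_real.
exact: f_le1.
Qed.

Lemma empirical_average_symmetric t (sigma : forall i, 'S_(N i)) x :
  empirical_average t (permute sigma x) = empirical_average t x.
Proof.
rewrite !empirical_averageE; congr (_ * _).
by rewrite [RHS](reindex_perm (sigma (tag t))).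
Qed.

(** Exchanging [tagged t] with [m] shows that the factor [f t] may be evaluated
    at any member [m] of its class, provided that this exchange leaves [H]
    unchanged. Averaging over [m] gives the empirical average; the at most
    [size L] excluded members each contribute an error of at most 2, divided by
    the class size. *)
Lemma replace_factor (H : finite_system S N -> R) (L : seq position)
    (t : position) :
  continuous H -> (forall x, `|H x| <= 1) ->
  (forall (m : 'I_(N (tag t))) x, existT _ (tag t) m \notin L ->
     H (permute (transpose m) x) = H x) ->
  `|E (fun x => H x * f t (coordinate t x)) -
    E (fun x => H x * empirical_average t x)| <=
  2 * (size L)%:R / (N (tag t))%:R.
Proof.
move=> Hc H1 Hinv; case: t Hinv => i n /= Hinv.
set t : position := existT _ i n.
pose e m := E (fun x => H x * f t (x i m)).
have cHf m : continuous (fun x => H x * f t (x i m)).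
  move=> x; apply: cvgM; first exact: Hc.
  exact: (f_coordinate_continuous (t := t)).
have bHf m x : `|H x * f t (x i m)| <= 1 by rewrite normrM mulr_ile1.
have e1 m : `|e m| <= 1.
  apply: (@Rintegral_bound _ _ (borel (finite_system S N))) => [|x].
    exact: continuous_borel_real.
  exact: bHf.
have Ni0 : (0 : R) < (N i)%:R by rewrite ltr0n.
have EE : E (fun x => H x * empirical_average t x) = (N i)%:R^-1 * \sum_m e m.
  transitivity (E (fun x => (N i)%:R^-1 * \sum_m (H x * f t (x i m)))).
    apply: eq_Rintegral => x _.
    by rewrite empirical_averageE /= mulrCA mulr_sumr.
  have bs (r : seq 'I_(N i)) x :
      `|\sum_(m <- r) (H x * f t (x i m))| <= (size r)%:R.
    rewrite (le_trans (ler_norm_sum _ _ _)) // -sum1_size natr_sum.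
    by apply: ler_sum => m _; exact: bHf.
  have cs (r : seq 'I_(N i)) :
      continuous (fun x => \sum_(m <- r) (H x * f t (x i m))).
    move=> x; apply: cvg_big => [|m _]; first exact: add_continuous.
    exact: cHf.
  rewrite RintegralZl //; last exact: integrable_continuous (bs _).
  congr (_ * _).
  elim: (index_enum _) => [|m r IH].
    by under eq_Rintegral do rewrite big_nil; rewrite Rintegral_cst1 big_nil.
  under eq_Rintegral do rewrite big_cons.
  rewrite big_cons RintegralD ?IH //.
    exact: integrable_continuous (bHf m).
  exact: integrable_continuous (bs r).
have en m : existT _ i m \notin L -> e m = e n.
  move=> mL; rewrite /e.
  rewrite -(exchangeable_Rintegral (transpose (t := t) m) (cHf n) (bHf n)).
  apply: eq_Rintegral => x _; rewrite (Hinv _ _ mL); congr (_ * f t _).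
  by rewrite /permute /Defs.reindex /transpose dfwith_in tpermL.
rewrite EE -/(e n).
have -> : e n - (N i)%:R^-1 * \sum_m e m = (N i)%:R^-1 * \sum_m (e n - e m).
  rewrite sumrB sumr_const card_ord mulrBr; congr (_ - _).
  by rewrite -[e n *+ _]mulr_natl mulKf // gt_eqF.
rewrite normrM normfV (gtr0_norm Ni0) mulrC ler_pM2r ?invr_gt0 //.
rewrite (le_trans (ler_norm_sum _ _ _)) //.
(* Only the members m with (i, m) in L contribute. *)
rewrite (bigID (fun m => existT _ i m \in L)) /=.
rewrite [X in _ + X]big1 ?addr0; last first.
  by move=> m mL; rewrite en // subrr normr0.
apply: (@le_trans _ _
  (\sum_(m < N i | existT (fun i => 'I_(N i)) i m \in L) 2)).
  apply: ler_sum => m _; rewrite (le_trans (ler_normB _ _)) //.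
  by have := e1 n; have := e1 m; lra.
rewrite sumr_const -[2 *+ _]mulr_natr ler_wpM2l // ler_nat.
rewrite -(card_in_image (f := fun m => existT (fun i => 'I_(N i)) i m)); last first.
  move=> m m' _ _ /eqP.
  by rewrite -tag_eqE /tag_eq /= eqxx /= tagged_asE => /eqP.
apply: leq_trans (card_size L); apply: subset_leq_card.
by apply/fintype.subsetP => _ /fintype.imageP[m mL ->].
Qed.

(** The factors are replaced one at a time. Empirical averages are symmetric,
    so those already introduced are absorbed into the symmetric factor [G], and
    each exchange only has to avoid the positions still in [L]. The separate
    bound [K] on the length keeps the error terms fixed as [L] shrinks. *)
Lemma product_replacement (L : seq position) (K : nat)
    (G : finite_system S N -> R) :
  uniq L -> (size L <= K)%N -> continuous G -> (forall x, `|G x| <= 1) ->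
  (forall (sigma : forall i, 'S_(N i)) x,
    G (permute sigma x) = G x) ->
  `|E (fun x => G x * \prod_(t <- L) f t (coordinate t x)) -
    E (fun x => G x * \prod_(t <- L) empirical_average t x)| <=
  \sum_(t <- L) 2 * K%:R / (N (tag t))%:R.
Proof.
elim: L G => [|t L IH] G.
  move=> _ _ _ _ _.
  have -> : E (fun x => G x * \prod_(t <- [::]) f t (coordinate t x)) =
            E (fun x => G x * \prod_(t <- [::]) empirical_average t x).
    by apply: eq_Rintegral => x _; rewrite !big_nil.
  by rewrite subrr normr0 big_nil.
move=> /= /andP[tL uL] LK Gc G1 Gs.
pose H x := G x * \prod_(t <- L) f t (coordinate t x).
have Hc : continuous H.
  move=> x; apply: cvgM; first exact: Gc.
  apply: cvg_big => [|t' _]; first exact: mul_continuous.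
  exact: f_coordinate_continuous.
have H1 x : `|H x| <= 1 by rewrite normrM mulr_ile1 // normr_prod_le1.
have Hinv (m : 'I_(N (tag t))) x : existT _ (tag t) m \notin L ->
    H (permute (transpose m) x) = H x.
  move=> mL; rewrite /H Gs; congr (_ * _).
  apply: eq_big_seq => t' t'L; congr (f t' _).
  rewrite /coordinate /permute /Defs.reindex /transpose.
  case: t tL {H Hc H1} m mL => i n tL /= m mL; case: t' t'L => i' n' /= t'L.
  case: (eqVneq i i') => [ii'|ii']; last by rewrite dfwith_out // perm1.
  subst i'; rewrite dfwith_in tpermD //.
    by apply: contraNneq tL => ->.
  by apply: contraNneq mL => ->.
have step1 := replace_factor Hc H1 Hinv.
pose G' x := G x * empirical_average t x.
have := IH G' uL (ltnW LK).
have G'c : continuous G'.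
  by move=> x; apply: cvgM; [exact: Gc | exact: empirical_average_continuous].
have G'1 x : `|G' x| <= 1 by rewrite normrM mulr_ile1 // empirical_average_le1.
have G's (sigma : forall i, 'S_(N i)) x : G' (permute sigma x) = G' x.
  by rewrite /G' Gs empirical_average_symmetric.
move=> /(_ G'c G'1 G's) step2.
rewrite big_cons.
have -> : E (fun x => G x * \prod_(t' <- t :: L) f t' (coordinate t' x)) =
          E (fun x => H x * f t (coordinate t x)).
  by apply: eq_Rintegral => x _; rewrite big_cons /H mulrCA mulrC.
have E2 : E (fun x => G' x * \prod_(t <- L) f t (coordinate t x)) =
          E (fun x => H x * empirical_average t x).
  by apply: eq_Rintegral => x _; rewrite /H /G' mulrAC.
have -> : E (fun x => G x * \prod_(t' <- t :: L) empirical_average t' x) =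
          E (fun x => G' x * \prod_(t <- L) empirical_average t x).
  by apply: eq_Rintegral => x _; rewrite big_cons /G' mulrA.
rewrite E2 in step2.
rewrite -(subrKA (E (fun x => H x * empirical_average t x))).
rewrite (le_trans (ler_normD _ _)) // lerD //.
apply: le_trans step1 _.
rewrite ler_wpM2r ?invr_ge0 ?ler0n // ler_wpM2l // ler_nat; exact: ltnW.
Qed.

End exchangeable_products.

(** * Products over the first rows *)

Section row_products.
Context (R : realType) (C : nat) (S : 'I_C -> ptopologicalType) (k : nat).
Variable f : forall i : 'I_C, 'I_k.+1 -> S i -> R.
Arguments f : clear implicits.
Hypothesis f_continuous : forall i n, continuous (f i n).
Hypothesis f_le1 : forall i n y, `|f i n y| <= 1.

Definition row_product (x : finite_system S (fun=> k.+1)) : R :=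
  \prod_i \prod_n f i n (x i n).

Definition measure_product (mu : measures S R) : R :=
  \prod_i \prod_n \int[mu i]_y f i n y.

Lemma row_product_le1 x : `|row_product x| <= 1.
Proof. by apply: normr_prod_le1 => i; exact: normr_prod_le1. Qed.

Lemma row_product_continuous : continuous row_product.
Proof.
move=> x; apply: cvg_big => [|i _]; first exact: mul_continuous.
apply: cvg_big => [|n _]; first exact: mul_continuous.
apply: (@continuous_comp _ _ _
  (coordinate (existT (fun i => 'I_k.+1) i n)) (f i n)).
  exact: coordinate_continuous.
exact: f_continuous.
Qed.

Lemma measure_product_le1 mu : `|measure_product mu| <= 1.
Proof.
apply: normr_prod_le1 => i; apply: normr_prod_le1 => n.
apply: (@Rintegral_bound _ _ (borel (S i)) (mu i)) => [|y]; last exact: f_le1.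
exact: continuous_borel_real.
Qed.

Lemma measure_product_continuous : continuous measure_product.
Proof.
move=> mu; apply: cvg_big => [|i _]; first exact: mul_continuous.
apply: cvg_big => [|n _]; first exact: mul_continuous.
have proj := @prod_proj_continuous _ (fun i => Prob R (S i)) i mu.
have [/(_ (@cvg_id _ _)) + _] := @weak_cvgP R (S i) (nbhs (mu i)) (mu i) _.
move=> /(_ _ (@f_continuous i n) (bounded_fun_le (f_le1 (i := i) n))) fi.
exact: (cvg_comp _ _ proj fi).
Qed.

(** Instance of [product_replacement] for the positions of the first rows. The
    bound depends on the system only through its class sizes, so that it applies
    both along the given sequence of systems and to the finite subsystems of the
    infinite one. *)
Lemma row_product_measure_product (N : 'I_C -> nat) d
    (Omega : measurableType d) (P : probability Omega R)
    (X : {RV P >-> borel (finite_system S N)}) (K : nat) :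
  multi_exchangeable X -> (0 < K)%N -> (forall i, k < N i)%N ->
  (forall i, K <= N i)%N ->
  `|\int[law_first_rows X k.+1]_x row_product x -
    \int[law (empirical_measure_vector X)]_mu measure_product mu| <=
  2 * (C * k.+1)%:R ^+ 2 / K%:R.
Proof.
move=> Xex K0 kN KN; rewrite /law_first_rows; case: pselect => // le.
rewrite (Rintegral_continuous_rv _ _ row_product_continuous row_product_le1).
rewrite (Rintegral_continuous_rv _ _ measure_product_continuous
  measure_product_le1).
pose L := [seq existT (fun i => 'I_(N i)) i (widen_ord (le i) n) |
  i <- enum 'I_C, n <- enum 'I_k.+1].
have uL : uniq L.
  apply: allpairs_uniq_dep; [exact: enum_uniq | by move=> *; exact: enum_uniq|].
  move=> [i n] [i' n'] _ _ /= /eqP.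
  rewrite -tag_eqE /tag_eq /= => /andP[/eqP ii'].
  by subst i'; rewrite tagged_asE => /eqP /(congr1 val) /= /val_inj ->.
have sL : size L = (C * k.+1)%N by rewrite size_allpairs !size_enum_ord.
(* Only the values of f' on L matter; there, inord recovers the row. *)
pose f' (t : {i : 'I_C & 'I_(N i)}) := f (tag t) (inord (tagged t)).
have N0 i : (0 < N i)%N by exact: leq_ltn_trans (kN i).
have prodL (h : {i : 'I_C & 'I_(N i)} -> R) :
    \prod_(t <- L) h t = \prod_i \prod_n h (existT _ i (widen_ord (le i) n)).
  rewrite big_allpairs_dep big_enum /=; apply: eq_bigr => i _.
  by rewrite big_enum.
have f'c t : continuous (f' t) by exact: f_continuous.
have f'1 t y : `|f' t y| <= 1 by exact: f_le1.
have := @product_replacement R C S N d Omega P X N0 Xex f' f'c f'1 L (C * k.+1)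
  (cst 1) uL _ _ _ _.
rewrite sL leqnn => /(_ isT (@cst_continuous _ _ _)).
have n1 (x : finite_system S N) : `|cst (1 : R) x| <= 1 by rewrite normr1.
move=> /(_ n1 (fun _ _ => erefl)) bound.
rewrite (_ : \int[_]_x row_product _ =
  \int[law X]_x (cst 1 x * \prod_(t <- L) f' t (coordinate t x))); last first.
  apply: eq_Rintegral => x _; rewrite /= mul1r prodL.
  apply: eq_bigr => i _; apply: eq_bigr => n _.
  by rewrite /f' /= inord_val.
rewrite (_ : \int[_]_x measure_product _ =
  \int[law X]_x (cst 1 x * \prod_(t <- L) empirical_average f' t x)); last first.
  apply: eq_Rintegral => x _; rewrite /= mul1r prodL.
  apply: eq_bigr => i _; apply: eq_bigr => n _.
  by rewrite /empirical_average /f' /= inord_val.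
apply: (le_trans bound).
apply: (@le_trans _ _ (\sum_(t <- L) 2 * (C * k.+1)%:R / K%:R)).
  apply: ler_sum => t _; rewrite ler_wpM2l ?mulr_ge0 ?ler0n //.
  by rewrite lef_pV2 ?posrE ?ltr0n // ler_nat.
rewrite big_const_seq count_predT sL iter_addr_0 -[leLHS]mulr_natl expr2.
by rewrite !mulrA [_ * 2]mulrC.
Qed.

(** The infinite system contains exchangeable systems of every size [K]. The
    left-hand side is the same for all of them, while the products over their
    empirical measures converge by the definition of the directing measures. *)
Lemma directing_measure_product d (Omega : measurableType d)
    (P : probability Omega R) (X : {RV P >-> borel (infinite_system S)})
    (Lambda : {RV P >-> borel (measures S R)}) :
  infinite_multi_exchangeable X -> directing_measure_vector X Lambda ->
  \int[law (subsystem X (fun=> k.+1))]_x row_product x =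
  \int[law Lambda]_mu measure_product mu.
Proof.
move=> Xex XL.
pose a K := \int[law (empirical_measure_vector (subsystem X (fun=> K)))]_mu
  measure_product mu.
have aL : a K @[K --> \oo] --> \int[law Lambda]_mu measure_product mu.
  have mM (Z : {RV P >-> borel (measures S R)}) :
      measurable_fun setT (fun w => measure_product (Z w)).
    have := continuous_borel_real measure_product_continuous.
    by move=> /measurableT_comp; apply.
  rewrite (Rintegral_law _ measure_product_continuous measure_product_le1).
  rewrite (_ : a = fun K => \int[P]_w measure_product
    (empirical_measure_vector (subsystem X (fun=> K)) w)); last first.
    apply/funext => K.
    exact: (Rintegral_law _ measure_product_continuous measure_product_le1).
  apply: (bounded_convergence (M := 1)) => // [n w|].
    exact: measure_product_le1.
  apply: filterS XL => w XLw.
  have emp_cvg : (fun K => empirical_vector R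
      (fun i (n : 'I_K) => X w i n : S i) : measures S R) @ \oo --> Lambda w.
    apply/cvg_sup => i A /= [_ [[B oB <-] Bx sBA]].
    apply: filterS sBA _.
    by apply: (XLw i); exact: open_nbhs_nbhs.
  have := cvg_comp _ _ emp_cvg (@measure_product_continuous _).
  exact.
have ab : a K @[K --> \oo] -->
    \int[law (subsystem X (fun=> k.+1))]_x row_product x.
  apply/cvgrPdist_le => e e0.
  pose c : R := 2 * (C * k.+1)%:R ^+ 2.
  exists (maxn k.+1 (Num.truncn (c / e)).+1) => // K /=.
  rewrite geq_max => /andP[kK cK].
  have K0 : (0 < K)%N by exact: leq_ltn_trans kK.
  have bound := row_product_measure_product (Xex (fun=> K) (fun=> K0)) K0
    (fun=> kK) (fun=> leqnn K).
  have E : \int[law_first_rows (subsystem X (fun=> K)) k.+1]_x row_product x =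
           \int[law (subsystem X (fun=> k.+1))]_x row_product x.
    rewrite /law_first_rows; case: pselect => [le|]; last by case.
    by rewrite !(Rintegral_law _ row_product_continuous row_product_le1).
  rewrite E in bound.
  apply: (le_trans bound); rewrite -/c ler_pdivrMr ?ltr0n // mulrC.
  rewrite -ler_pdivrMr //.
  by rewrite (le_trans (ltW (truncnS_gt _))) // ler_nat.
by apply: cvg_unique aL => //; exact: Rhausdorff.
Qed.

End row_products.

(** * Monomials of the generating families are products over rows *)

Section moments_as_products.
Context (R : realType) (C : nat) (S : 'I_C -> ptopologicalType)
  (u : forall i, nat -> S i -> R).
Arguments u : clear implicits.
Hypothesis uI : forall i, initial_family (u i).

Let word_continuous i s : continuous (monomial (u i) s).
Proof. by apply: continuous_monomial; have [] := uI i. Qed.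

Let word_le1 i s y : `|monomial (u i) s y| <= 1.
Proof. by apply: monomial_le1; have [] := uI i. Qed.

Definition row_family k (t : {i : 'I_C & {n : 'I_k & nat}})
    (x : finite_system S (fun=> k)) : R :=
  u (tag t) (tagged (tagged t)) (x (tag t) (tag (tagged t))).

Definition measure_family (t : {i : 'I_C & seq nat}) (mu : measures S R) : R :=
  \int[mu (tag t)]_y monomial (u (tag t)) (tagged t) y.

Lemma row_family_initial k : initial_family (@row_family k).
Proof.
apply: (@initial_family_prod R _ (fun i => {ptws 'I_k -> S i})
  (fun=> {n : 'I_k & nat})
  (fun i s (x : {ptws 'I_k -> S i}) => u i (tagged s) (x (tag s)))) => i.
exact: (@initial_family_prod R _ (fun=> S i) (fun=> nat) (fun=> u i)).
Qed.

Lemma measure_family_initial : initial_family measure_family.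
Proof.
apply: (@initial_family_prod R _ (fun i => Prob R (S i)) (fun=> seq nat)
  (fun i s (mu : Prob R (S i)) => \int[mu]_y monomial (u i) s y)) => i.
exact: initial_family_moments.
Qed.

(** The factors of a word are grouped by the coordinate that they read. *)
Lemma row_monomial k (w : seq {i : 'I_C & {n : 'I_k.+1 & nat}}) :
  exists f : forall i : 'I_C, 'I_k.+1 -> S i -> R,
    [/\ forall i n, continuous (f i n), forall i n y, `|f i n y| <= 1 &
        monomial (@row_family k.+1) w = row_product f].
Proof.
pose at_ (i : 'I_C) (n : 'I_k.+1) (t : {i : 'I_C & {n : 'I_k.+1 & nat}}) :=
  (tag t == i) && (tag (tagged t) == n).
pose letter (t : {i : 'I_C & {n : 'I_k.+1 & nat}}) : nat := tagged (tagged t).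
exists (fun i n => monomial (u i) [seq letter t | t <- w & at_ i n t]); split.
- by move=> i n; exact: word_continuous.
- by move=> i n; exact: word_le1.
- apply/funext => x; rewrite /row_product pair_big /=.
  under [RHS]eq_bigr do rewrite /monomial big_map big_filter.
  rewrite /monomial (exchange_big_dep xpredT) //=; apply: eq_bigr => t _.
  rewrite (big_pred1 (tag t, tag (tagged t))) // => -[i n] /=.
  by rewrite /at_ xpair_eqE [i == _]eq_sym [n == _]eq_sym.
Qed.

(** The [n]-th factor of a word is given row [n] to itself, because a product of
    several integrals against the same measure corresponds to distinct members
    of the class. All the other entries, and the extra row that keeps the number
    of rows positive, carry the empty word, whose integral is 1. *)
Lemma measure_monomial (i0 : 'I_C) (w : seq {i : 'I_C & seq nat}) :
  exists f : forall i : 'I_C, 'I_(size w).+1 -> S i -> R,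
    [/\ forall i n, continuous (f i n), forall i n y, `|f i n y| <= 1 &
        monomial measure_family w = measure_product f].
Proof.
pose t0 : {i : 'I_C & seq nat} := existT _ i0 [::].
pose at_ (i : 'I_C) n : seq nat :=
  if tag (nth t0 w n) == i then tagged (nth t0 w n) else [::].
exists (fun i n => monomial (u i) (at_ i n)); split.
- by move=> i n; exact: word_continuous.
- by move=> i n; exact: word_le1.
have int1 (S' : ptopologicalType) (v : nat -> S' -> R) (mu : Prob R S') :
    \int[mu]_y monomial v [::] y = 1.
  rewrite -[RHS](Rintegral_cst1 mu); apply: eq_Rintegral => y _.
  by rewrite /monomial big_nil.
apply/funext => mu; rewrite /measure_product exchange_big /=.
have rowE n : \prod_i \int[mu i]_y monomial (u i) (at_ i n) y =
    measure_family (nth t0 w n) mu.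
  rewrite (bigD1 (tag (nth t0 w n))) //= /at_ eqxx big1 ?mulr1 // => i.
  by rewrite eq_sym => /negbTE ->; exact: int1.
under [RHS]eq_bigr do rewrite rowE.
rewrite big_ord_recr /= nth_default // [X in _ * X]int1 mulr1.
by rewrite /monomial (big_nth t0) big_mkord.
Qed.

End moments_as_products.

(** * The equivalence *)

Theorem theorem3p2 (R : realType) (C : nat) (S : 'I_C -> ptopologicalType)
    (d : ('I_C -> nat) -> measure_display)
    (Omega : forall N : 'I_C -> nat, measurableType (d N))
    (P : forall N : 'I_C -> nat, probability (Omega N) R)
    (XN : forall N : 'I_C -> nat, {RV (P N) >-> borel (finite_system S N)})
    (d' : measure_display) (Omega' : measurableType d')
    (P' : probability Omega' R)
    (X : {RV P' >-> borel (infinite_system S)})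
    (Lambda : {RV P' >-> borel (measures S R)})
    (N_ : nat -> 'I_C -> nat) :
  (0 < C)%N ->
  (forall i, polish R (S i)) ->
  (forall N : 'I_C -> nat, (forall i, 0 < N i)%N ->
     multi_exchangeable (XN N)) ->
  infinite_multi_exchangeable X ->
  directing_measure_vector X Lambda ->
  (forall m i, 0 < N_ m i)%N ->
  tends_to_infinity N_ ->
  system_cvg_in_law (fun m => XN (N_ m)) X <->
  cvg_in_law (fun m => empirical_measure_vector (XN (N_ m))) Lambda.
Proof.
move=> C0 Spolish XNex Xex XL N0 Ninf.
have [u uI] : exists u : forall i, nat -> S i -> R,
    forall i, initial_family (u i).
  exists (fun i => sval (cid (polish_initial_family (Spolish i)))) => i.
  exact: svalP.
have close k (f : forall i : 'I_C, 'I_k.+1 -> S i -> R) :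
    (forall i n, continuous (f i n)) -> (forall i n y, `|f i n y| <= 1) ->
    (\int[law_first_rows (XN (N_ m)) k.+1]_x row_product f x -
     \int[law (empirical_measure_vector (XN (N_ m)))]_mu measure_product f mu)
    @[m --> \oo] --> (0 : R).
  move=> fc f1; apply/cvgrPdist_le => e e0.
  pose c : R := 2 * (C * k.+1)%:R ^+ 2.
  have := Ninf (maxn k.+1 (Num.truncn (c / e)).+1).
  apply: filterS => m Nm.
  have kN i : (k < N_ m i)%N by apply: leq_trans (Nm i); rewrite leq_maxl.
  have KN i : ((Num.truncn (c / e)).+1 <= N_ m i)%N.
    by apply: leq_trans (Nm i); rewrite leq_maxr.
  rewrite sub0r normrN.
  have bound := row_product_measure_product fc f1 (XNex _ (N0 m)) _ kN KN.
  apply: (le_trans (bound _)) => //.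
  rewrite -/c ler_pdivrMr ?ltr0n // mulrC -ler_pdivrMr //.
  exact: ltW (truncnS_gt _).
split=> [Xcvg|Lcvg].
  apply: (cvg_moments (measure_family_initial uI)) => w.
  have [f [fc f1 ->]] := measure_monomial uI (Ordinal C0) w.
  rewrite -(directing_measure_product fc f1 Xex XL).
  have rows_cvg : (fun m =>
      \int[law_first_rows (XN (N_ m)) (size w).+1]_x row_product f x) @ \oo -->
      \int[law (subsystem X (fun=> (size w).+1))]_x row_product f x.
    have /weak_cvgP := Xcvg (size w).+1 isT; apply.
      exact: row_product_continuous.
    exact: bounded_fun_le (row_product_le1 f1).
  have := cvgB rows_cvg (close _ _ fc f1); rewrite subr0.
  rewrite (_ : (_ - _)%R = fun m =>
    \int[law (empirical_measure_vector (XN (N_ m)))]_mu measure_product f mu).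
    by apply.
  by apply/funext => m; exact: subKr.
move=> [//|k] _.
apply: (cvg_moments (row_family_initial uI k.+1)) => w.
have [f [fc f1 ->]] := row_monomial uI w.
rewrite (directing_measure_product fc f1 Xex XL).
have measures_cvg : (fun m =>
    \int[law (empirical_measure_vector (XN (N_ m)))]_mu
      measure_product f mu) @ \oo --> \int[law Lambda]_mu measure_product f mu.
  have /weak_cvgP := Lcvg; apply; first exact: measure_product_continuous.
  exact: bounded_fun_le (measure_product_le1 fc f1).
have := cvgD measures_cvg (close _ _ fc f1); rewrite addr0.
rewrite (_ : (_ + _)%R = fun m =>
  \int[law_first_rows (XN (N_ m)) k.+1]_x row_product f x); first by apply.
by apply/funext => m; exact: subrKC.
Qed.
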